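(* Let $r,t,n$ be integers with $1\le t<r$, and let $\mathcal{C}=\mathcal{C}_{n,t}^{(r)}$ be the $r$-uniform $t$-tight cycle of order $n$ and length $\ell>2$. Then $\chi^{e}(\mathcal{C})=3$ if $t=\frac r2$ and $\ell\not\equiv 0\pmod 4$; $\chi^{e}(\mathcal{C})=2$ if either ($t=\frac r2$ and $\ell\equiv 0\pmod 4$) or ($t>\frac r2$ and $r-t$ divides $r$); and $\chi^{e}(\mathcal{C})=1$ otherwise.
   Context: The $r$-uniform $t$-tight cycle $\mathcal{C}_{n,t}^{(r)}$ has vertex set $\{1,\dots,n\}$ and edges $e_1,\dots,e_\ell$, where $\ell=\frac{n}{r-t}$ is an integer and $e_i=\{(i-1)(r-t)+1,(i-1)(r-t)+2,\dots,(i-1)(r-t)+r\}$ with vertex labels taken modulo $n$; consecutive edges (cyclically) share exactly $t$ vertices. For $w:E\to\{1,\dots,k\}$, $\sigma^{e}(v)=\sum_{e\ni v}w(e)$; a vertex coloring is proper if every edge contains two vertices of distinct colors; $\chi^{e}(\mathcal{H})$ is the least $k$ such that some $w$ makes $\sigma^{e}$ proper. *)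

(* Defs.v *)
From mathcomp Require Import all_boot.

Set Implicit Arguments.
Unset Strict Implicit.
Unset Printing Implicit Defensive.

(* A hypergraph on the vertex set T is given by its set of edges E. *)
Section EdgeWeighting.

Variables (T : finType) (E : {set {set T}}).

(* sigma^e; only the values of w on E matter. *)
Definition sigma_e (w : {set T} -> nat) (v : T) : nat :=
  \sum_(e in E | v \in e) w e.

Definition proper_coloring (c : T -> nat) : Prop :=
  forall e : {set T}, e \in E ->
    exists u v : T, [/\ u \in e, v \in e & c u <> c v].

Definition sigma_e_colorable (k : nat) : Prop :=
  exists w : {set T} -> nat,
    (forall e : {set T}, e \in E -> 1 <= w e <= k) /\
    proper_coloring (sigma_e w).

(* chi^e (E) = k.  A relation, since no k works for some hypergraphs, such as
   one with a single edge. *)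
Definition chi_e_is (k : nat) : Prop :=
  sigma_e_colorable k /\ (forall m : nat, sigma_e_colorable m -> k <= m).

End EdgeWeighting.

(* Vertices and edge indices are numbered from 0: the vertex labelled j is the
   ordinal j - 1, and tight_cycle_edge n r t i is the edge e_(i+1). *)
Definition tight_cycle_edge (n r t i : nat) : {set 'I_n} :=
  [set v : 'I_n | [exists j : 'I_r, v == (i * (r - t) + j) %% n :> nat]].

(* These n / (r - t) edges have r elements each and are pairwise distinct
   when t < r < n and r - t divides n; for n <= r they all coincide with the
   whole vertex set. *)
Definition tight_cycle (n r t : nat) : {set {set 'I_n}} :=
  [set tight_cycle_edge n r t i | i : 'I_(n %/ (r - t))].

(* Main.v *)
Require Import Defs.
From mathcomp Require Import all_boot zify.

Set Implicit Arguments.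
Unset Strict Implicit.
Unset Printing Implicit Defensive.

(* Put d = r - t and cut the n = l * d vertices into l consecutive blocks of
   length d.  If d does not divide r, then with constant weights the first and
   the last vertex of a block have different degrees, and every edge contains a
   whole block, so one weight is enough.  If r = q * d, then sigma^e
   is constant on each block, equal to a sum of q cyclically consecutive weights;
   two neighbouring sums agree iff f j = f (j + q) for the weights f.  Hence a
   proper weighting is a cyclic word f of length l such that among any q - 1
   consecutive positions j some satisfies f j <> f (j + q).  Constant words never
   work.  For q >= 3 alternating blocks of length q, possibly with one letter
   flipped, give a binary word.  For q = 2 one needs a proper colouring of the
   graph j ~ j + 2 on Z/l: an odd cycle when l is odd, and two cycles of length
   l / 2 when l is even. *)

(** * Cyclic words and sums over sliding windows *)

Definition nowhere_periodic (T : eqType) (q : nat) (f : nat -> T) : Prop :=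
  forall i, exists j, i < j < i + q /\ f j != f (j + q).

Definition window_sum (q : nat) (f : nat -> nat) (c : nat) : nat :=
  \sum_(m < q) f (c + m).

Lemma window_sumS q f c :
  window_sum q f c.+1 + f c = window_sum q f c + f (c + q).
Proof.
rewrite /window_sum -(big_ord_recr q (fun m => f (c + m))) big_ord_recl addn0 addnC.
by congr (_ + _); apply: eq_bigr => m _; rewrite /= addnS addSn.
Qed.

(** By [window_sumS], moving the window from [j] to [j.+1] trades [f j] for [f (j + q)], so [q - 1]
    consecutive coincidences equate [q] successive sums. *)
Lemma window_sum_const q f i :
  (forall j, i < j < i + q -> f j = f (j + q)) ->
  forall a, a < q -> window_sum q f (i.+1 + a) = window_sum q f i.+1.
Proof.
move=> fE; elim=> [|a IHa] a_lt; first by rewrite addn0.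
have := window_sumS q f (i.+1 + a); rewrite -fE; last by lia.
by move/addIn; rewrite addnS => ->; apply: IHa; lia.
Qed.

(** Shifting by [q] and reducing modulo [l] leaves one period of starts; [j] is then compared with
    its partner [j - q], written [j + (l - q)] to stay in the naturals. *)
Lemma nowhere_periodic_mod (T : eqType) (q l : nat) (f : nat -> T) :
  q < l ->
  (forall i, i < l ->
    exists j, i < j < i + q /\ f (j %% l) != f ((j + (l - q)) %% l)) ->
  nowhere_periodic q (fun i => f (i %% l)).
Proof.
move=> q_lt np i; have l_gt0 : 0 < l by lia.
have [j [ij neq]] := np _ (ltn_pmod (i + q) l_gt0).
have iqE := divn_eq (i + q) l.
exists (j + (i + q) %/ l * l - q); split; first by lia.
have -> : j + (i + q) %/ l * l - q + q = (i + q) %/ l * l + j by lia.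
rewrite modnMDl eq_sym.
have -> : (j + (i + q) %/ l * l - q) %% l = (j + (l - q)) %% l; last by [].
rewrite -[LHS]modnDr (_ : _ + l = (i + q) %/ l * l + (j + (l - q))); last by lia.
by rewrite modnMDl.
Qed.

(** * Words on Z/l: constructions for [q >= 3] and for [q = 2], and the obstruction modulo 4 *)

Lemma odd_divB q x : 0 < q -> q <= x -> odd (x %/ q) = ~~ odd ((x - q) %/ q).
Proof. by move=> q_gt0 q_le; rewrite -{1}(subnK q_le) divnDr // divnn q_gt0 addn1. Qed.

(* Blocks of length [q] alternate, except that position 1 is flipped when the
   seam at [l] would otherwise create [q - 1] consecutive coincidences. *)
Definition block_coloring (q l j : nat) : bool :=
  odd (j %/ q) (+)
  [&& j == 1, odd (l.+1 %/ q) & l.+1 %% q <= 2].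

Lemma block_coloring_neq1 q l j : j != 1 -> block_coloring q l j = odd (j %/ q).
Proof. by rewrite /block_coloring => /negPf ->; rewrite addbF. Qed.

(** Positions in [[q, l)] differ from their partners, except possibly [q.+1], whose partner 1 may be
    flipped. They serve every window but those with [i = 0] and [i = l.-1], which lie below [q]
    modulo [l] and use position 1, or else [q.-1] and [q.-2]. *)
Lemma block_coloring_nowhere_periodic q l :
  2 < q -> q < l -> nowhere_periodic q (fun i => block_coloring q l (i %% l)).
Proof.
move=> q_gt2 q_lt; apply: nowhere_periodic_mod => // i i_lt.
have q_gt0 : 0 < q by lia.
pose g := block_coloring q l.
have gE j : j != 1 -> g j = odd (j %/ q) by apply: block_coloring_neq1.
have small j : j < q -> j %/ q = 0 by move=> ?; rewrite divn_small.
have good j : q <= j < l -> j != q.+1 -> g (j %% l) != g ((j + (l - q)) %% l).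
  move=> jq neq; rewrite (_ : j + (l - q) = j - q + l); last by lia.
  rewrite modnDr !modn_small //; try lia.
  rewrite !gE; try lia.
  by rewrite (odd_divB q_gt0); [case: odd | lia].
have good_top j : q <= j < l -> ~~ (odd (l.+1 %/ q) && (l.+1 %% q <= 2)) ->
    g (j %% l) != g ((j + (l - q)) %% l).
  move=> jq /negPf sp; rewrite (_ : j + (l - q) = j - q + l); last by lia.
  rewrite modnDr !modn_small //; try lia.
  rewrite /g /block_coloring sp !andbF !addbF.
  by rewrite (odd_divB q_gt0); [case: odd | lia].
have low j : j < q -> (j + (l - q)) %% l = l + j - q.
  by move=> j_lt; rewrite modn_small //; lia.
have lowE j : j < q -> odd ((l + j - q) %/ q) = ~~ odd ((l + j) %/ q).
  by move=> j_lt; rewrite [in RHS](odd_divB q_gt0) ?negbK //; lia.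
have lE := divn_eq l.+1 q.
have c_lt := ltn_pmod l.+1 q_gt0.
(* The partner of position 1 carries [~~ odd (l.+1 %/ q)]; when this is false, the flip makes
   position 1 differ from it. *)
have good1 : odd (l.+1 %/ q) ==> (l.+1 %% q <= 2) ->
    g (1 %% l) != g ((1 + (l - q)) %% l).
  move=> h; rewrite low; last by lia.
  rewrite modn_small; last by lia.
  rewrite [g (l + _ - _)]gE; last by lia.
  rewrite lowE; last by lia.
  rewrite addn1 /g /block_coloring eqxx small /=; last by lia.
  by case: odd h => //= ->.
(* The partners of [q.-1] and [q.-2] sit in the odd block [l.+1 %/ q], at offsets [l.+1 %% q] minus
   2 and minus 3; hence the bound [2 < l.+1 %% q]. *)
have goodk k : k + 1 = q \/ k + 2 = q -> odd (l.+1 %/ q) -> 2 < l.+1 %% q ->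
    g (k %% l) != g ((k + (l - q)) %% l).
  move=> kq a_odd c_gt; rewrite low ?modn_small; try lia.
  have -> : g k = false.
    rewrite /g /block_coloring small ?a_odd /=; last by lia.
    by apply/negbTE; rewrite negb_and -ltnNge c_gt orbT.
  have lk : l + k - q = l.+1 %/ q * q + (l.+1 %% q - (q - k + 1)) by lia.
  have q_le : q <= l.+1 %/ q * q by rewrite leq_pmull //; case: (_ %/ _) a_odd.
  rewrite gE; last by move: lE lk q_le; move: (_ %/ _ * _) => x; lia.
  by rewrite lk divnMDl // (small (_ - _)) ?addn0 ?a_odd //; lia.
have a_pos : odd (l.+1 %/ q) -> 0 < l.+1 %/ q by case: (_ %/ _).
case: (boolP (odd (l.+1 %/ q) ==> (l.+1 %% q <= 2))) => [h1 | ].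
  have {}good1 := good1 h1.
  have [i0|i_gt0] := posnP i; first by exists 1; split=> //; lia.
  have [il|i_neq] := eqVneq i.+1 l.
    exists l.+1; split; first by lia.
    by rewrite -[l.+1]add1n -addnA [l + _]addnC addnA !modnDr.
  have [i2|i_neq2] := eqVneq i 2.
    by exists q; split; [lia | apply: good; lia].
  have [sp|nsp] := boolP (odd (l.+1 %/ q) && (l.+1 %% q <= 2)); last first.
    (* The last position of the window, capped so as to stay in [[q, l)]. *)
    exists (minn (i + q.-1) l.-1); split; first by lia.
    by apply: good_top => //; lia.
  exists (minn (i + q.-1) l.-1); split; first by lia.
  apply: good; first by lia.
  (* As [i] is not 2, this position is [q.+1] only if [l = q + 2], which contradicts an odd quotient
     with remainder at most 2. *)
  case/andP: sp => a_odd c_le; have a_gt0 := a_pos a_odd.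
  have : l.+1 %/ q = 1 \/ 2 < l.+1 %/ q by case: (_ %/ _) a_odd a_gt0 => [|[|[|]]] //=; lia.
  case=> [a1 | a_gt2]; first by rewrite a1 in lE; lia.
  have : 3 * q <= l.+1 %/ q * q by rewrite leq_pmul2r.
  lia.
rewrite negb_imply -ltnNge => /andP[a_odd c_gt].
have nsp : ~~ (odd (l.+1 %/ q) && (l.+1 %% q <= 2)).
  by rewrite negb_and -ltnNge c_gt orbT.
have [i0|i_gt0] := posnP i.
  by exists q.-1; split; [lia | apply: goodk => //; lia].
have [il|i_neq] := eqVneq i.+1 l.
  exists (q.-2 + l); split; first by lia.
  by rewrite addnAC !modnDr; apply: goodk => //; lia.
by exists (minn (i + q.-1) l.-1); split; [lia | apply: good_top => //; lia].
Qed.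

(* The word 0011 repeated; when [4] does not divide [l] its last two letters are
   replaced by 2, except that for [l = 3] all three letters must differ. *)
Definition pair_coloring (l j : nat) : nat :=
  if l == 3 then j else if (l <= j.+2) && ~~ (4 %| l) then 2 else odd j./2.

Lemma pair_coloring_le l j : j < l -> pair_coloring l j <= 2 - (4 %| l).
Proof.
rewrite /pair_coloring; case: eqP => [->|_] //.
by case: dvdn; rewrite ?andbF ?andbT; do ?case: ifP; case: odd.
Qed.

Lemma pair_coloring_nowhere_periodic l :
  2 < l -> nowhere_periodic 2 (fun i => pair_coloring l (i %% l)).
Proof.
move=> l_gt2; apply: nowhere_periodic_mod => // i i_lt.
exists i.+1; split; first by lia.
have sq j : odd j.+2./2 = ~~ odd j./2 by [].
rewrite /pair_coloring; case: (l =P 3) => [l3|l_neq3].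
  by rewrite l3 in i_lt |- *; case: i i_lt => [|[|[|]]].
have -> : (i.+1 + (l - 2)) %% l = if i == 0 then l.-1 else i.-1.
  case: i i_lt => [|i] i_lt /=; first by rewrite modn_small; lia.
  by rewrite (_ : i.+2 + (l - 2) = i + l) ?modnDr ?modn_small //; lia.
have -> : i.+1 %% l = if i.+1 == l then 0 else i.+1.
  by case: eqP => [->|?]; rewrite ?modnn ?modn_small //; lia.
have [l4|nl4] /= := boolP (4 %| l); rewrite ?andbF ?andbT; last first.
  case: i i_lt => [|i] i_lt /=.
    rewrite (_ : (1 == l) = false) /=; last by lia.
    rewrite (_ : (l <= 3) = false) /=; last by lia.
    by rewrite (_ : l <= l.-1.+2); lia.
  have [il|i_neq] := eqVneq i.+2 l; first by rewrite il leqnn leqNgt l_gt2.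
  rewrite (_ : (l <= i.+2) = false); last by lia.
  by case: leqP => _; rewrite ?sq; case: odd.
case: i i_lt => [|i] i_lt /=.
  rewrite (_ : (1 == l) = false) /=; last by lia.
  have /dvdnP[m lm] := l4; rewrite (_ : l.-1 = (m.-1.*2).+1.*2.+1); last by lia.
  by rewrite /= uphalf_double /= odd_double.
have [il|i_neq] := eqVneq i.+2 l; last by rewrite sq; case: odd.
have /dvdnP[m lm] := l4; rewrite (_ : i = (m.-1.*2).+1.*2); last by lia.
by rewrite half_double /= odd_double.
Qed.

(** Two letters must alternate along the odd positions. Going round twice takes [l] alternations, so
    [l] is even; going round once then takes [l./2], so [l./2] is even too. *)
Lemma nowhere_periodic2_dvd4 l (f : nat -> nat) :
  (forall i, 0 < f i <= 2) -> (forall i, f (i %% l) = f i) ->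
  nowhere_periodic 2 f -> 4 %| l.
Proof.
move=> f_le f_mod np.
have step i : (f i.+3 == 1) = ~~ (f i.+1 == 1).
  have [j [ij]] := np i; have -> : j = i.+1 by lia.
  have := f_le i.+1; have := f_le i.+3; rewrite addn2; lia.
have alternate k : (f (k.*2).+1 == 1) = odd k (+) (f 1 == 1).
  by elim: k => [|k IHk] //; rewrite doubleS step IHk /= addNb.
have period i m : f (m * l + i) = f i by rewrite -f_mod modnMDl f_mod.
have l_even : ~~ odd l.
  have := alternate l; rewrite -addn1 -mul2n period.
  by case: odd; case: eqP.
have f_l : f l.+1 = f 1 by rewrite -[l in LHS]mul1n -addn1 period.
have := alternate l./2; rewrite even_halfK // f_l => h.
have h2 : ~~ odd l./2 by case: odd h; case: eqP.
by rewrite -(even_halfK l_even) -(even_halfK h2) -!muln2 -mulnA dvdn_mull.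
Qed.

(** * The tight cycle in block coordinates: incidence and vertex sums *)

Section TightCycle.

Variables (r t l : nat).
Let d := r - t.
Let n := l * d.
Hypotheses (d_gt0 : 0 < d) (l_gt0 : 0 < l) (r_lt_n : r < n).

Let n_gt0 : 0 < n. Proof. by rewrite muln_gt0 l_gt0. Qed.

Let vertex (x : nat) : 'I_n := Ordinal (ltn_pmod x n_gt0).
Let edge (i : nat) : {set 'I_n} := tight_cycle_edge n r t i.

Lemma tight_cycleE : tight_cycle n r t = [set edge i | i : 'I_l].
Proof.
rewrite /tight_cycle /edge.
suff -> : n %/ (r - t) = l by [].
by rewrite mulnK.
Qed.

Lemma vertexD x o k : vertex ((x + k * l) * d + o) = vertex (x * d + o).
Proof.
by apply: val_inj; rewrite /= mulnDl -mulnA -/n addnAC addnC modnMDl.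
Qed.

Lemma edgeD i k : edge (i + k * l) = edge i.
Proof.
apply/setP=> v; rewrite !inE; apply: eq_existsb => j.
by rewrite mulnDl -mulnA -/d -/n addnAC addnC modnMDl.
Qed.

Lemma edge_mod i : edge (i %% l) = edge i.
Proof. by rewrite {2}(divn_eq i l) addnC edgeD. Qed.

Lemma edge_in i : edge i \in tight_cycle n r t.
Proof.
rewrite tight_cycleE -edge_mod.
by apply/imsetP; exists (Ordinal (ltn_pmod i l_gt0)).
Qed.

Lemma mem_edge i a o :
  a < l -> o < d -> (vertex ((i + a) * d + o) \in edge i) = (a * d + o < r).
Proof.
move=> a_lt o_lt; have ao_lt : a * d + o < n.
  by apply: leq_trans (leq_mul a_lt (leqnn d)); rewrite mulSn; lia.
rewrite inE mulnDl -addnA; apply/existsP/idP => [[j] | lt_r].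
  rewrite eqn_modDl !modn_small // => [/eqP -> //|].
  exact: ltn_trans r_lt_n.
by exists (Ordinal lt_r).
Qed.

Lemma mem_edgeP i v :
  v \in edge i ->
  exists a o, [/\ a < l, o < d, a * d + o < r & v = vertex ((i + a) * d + o)].
Proof.
rewrite inE => /existsP[j /eqP vE].
have j_lt : j < n by apply: ltn_trans r_lt_n.
exists (j %/ d), (j %% d); rewrite -divn_eq ltn_pmod // ltn_divLR //; split=> //.
by apply: val_inj; rewrite /= vE mulnDl -addnA -divn_eq.
Qed.

(* The vertex preceding the first vertex of [edge i] is the last one in the
   cyclic order starting at [edge i], hence outside it. *)
Lemma edge_inj i k : i < l -> k < l -> edge i = edge k -> i = k.
Proof.
move=> i_lt k_lt eik; apply/eqP; apply: contraT => neq_ik.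
pose a := (i + (l - k)) %% l.
have a_lt : a < l by rewrite ltn_pmod.
have kaE : (k + a) %% l = i.
  rewrite modnDmr (_ : k + _ = i + l) ?modnDr ?modn_small //; lia.
have a_gt0 : 0 < a.
  rewrite lt0n; apply: contraNneq neq_ik => a0.
  by have := kaE; rewrite a0 addn0 modn_small // => ->.
have kaD : exists m, k + a = i + m * l.
  by exists ((k + a) %/ l); rewrite {1}(divn_eq (k + a) l) kaE // addnC.
have [m kam] := kaD.
have : vertex ((i + 0) * d + 0) \in edge i by rewrite mem_edge //; lia.
rewrite eik (addn0 i) -(vertexD _ _ m) -kam mem_edge // addn0 => ad_lt.
have ad_lt' : a.-1 * d + d.-1 < r.
  apply: leq_ltn_trans ad_lt; rewrite -{2}(prednK a_gt0) mulSn; lia.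
have : vertex ((k + a.-1) * d + d.-1) \in edge k by rewrite mem_edge //; lia.
rewrite -(vertexD _ _ 1) -eik.
rewrite (_ : k + a.-1 + 1 * l = i + l.-1 + m * l); last by lia.
rewrite vertexD mem_edge ?prednK //; lia.
Qed.

(** Edges through block [x] are indexed by the number [a] of blocks by which they start earlier;
    [+ l] guards the truncated subtraction. *)
Lemma sigma_vertex w x o :
  o < d ->
  sigma_e (tight_cycle n r t) w (vertex (x * d + o)) =
  \sum_(a < l | a * d + o < r) w (edge (x + l - a)).
Proof.
move=> o_lt; rewrite /sigma_e tight_cycleE big_mkcondr /=.
rewrite big_imset /=; last first.
  by move=> i k _ _ /edge_inj H; apply: val_inj; apply: H.
pose h (a : 'I_l) : 'I_l := Ordinal (ltn_pmod (x + l - a) l_gt0).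
have h_inj : injective h.
  move=> a b /(congr1 val) /= /eqP hab; apply: val_inj => /=.
  have := ltn_ord a; have := ltn_ord b => b_lt a_lt.
  have : x + l - a + (a + b) == x + l - b + (a + b) %[mod l] by rewrite eqn_modDr.
  rewrite (_ : x + l - a + _ = x + l + b); last by lia.
  rewrite (_ : x + l - b + _ = x + l + a); last by lia.
  by rewrite eqn_modDl !modn_small // => /eqP.
rewrite (reindex_inj h_inj) /= [RHS]big_mkcond /=; apply: eq_bigr => a _.
rewrite edge_mod -(vertexD x o 1) mul1n.
rewrite -{1}(@subnK a (x + l)) ?mem_edge //.
by have := ltn_ord a; lia.
Qed.

Lemma sigma_vertex_count w x o p :
  o < d -> p <= l -> (forall a, (a * d + o < r) = (a < p)) ->
  sigma_e (tight_cycle n r t) w (vertex (x * d + o)) =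
  \sum_(a < p) w (edge (x + l - a)).
Proof.
move=> o_lt p_le pE; rewrite sigma_vertex //.
rewrite (big_ord_widen l (fun a => w (edge (x + l - a)))) //.
by apply: eq_bigl => a.
Qed.

Lemma colorable_gt0 m : sigma_e_colorable (tight_cycle n r t) m -> 0 < m.
Proof. by case=> w [/(_ _ (edge_in 0))]; lia. Qed.

Lemma colorable1 : ~~ (d %| r) -> d <= r -> sigma_e_colorable (tight_cycle n r t) 1.
Proof.
move=> ndr d_le; exists (fun => 1); split=> [e _ // |e].
rewrite {1}tight_cycleE => /imsetP[i _ ->].
have s_gt0 : 0 < r %% d by rewrite lt0n.
have s_lt : r %% d < d by rewrite ltn_pmod.
have rE := divn_eq r d.
have q_gt0 : 0 < r %/ d by rewrite divn_gt0.
have q_lt : r %/ d < l.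
  by rewrite -(ltn_pmul2r d_gt0) (leq_ltn_trans (leq_divM r d)).
(* Offset 0 lies in [(r %/ d).+1] edges; [r %% d] is the first offset lying in only [r %/ d]. *)
exists (vertex ((i + 0) * d + 0)), (vertex ((i + 0) * d + r %% d)).
have s_lt_r := leq_trans s_lt d_le.
rewrite !mem_edge //; split=> //; first exact: leq_ltn_trans s_lt_r.
rewrite (@sigma_vertex_count _ _ _ (r %/ d).+1) //.
  rewrite (@sigma_vertex_count _ _ _ (r %/ d)) ?(ltnW q_lt) //.
    by rewrite !sum1_card !card_ord; lia.
  by move=> a; rewrite [X in (_ < X) = _]rE ltn_add2r ltn_pmul2r.
move=> a; rewrite addn0 ltnS; apply/idP/idP=> [lt_r|].
  by rewrite leq_divRL // ltnW.
by rewrite leq_divRL // leq_eqVlt => /orP[/eqP aE|//]; rewrite -aE modnMl in s_gt0.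
Qed.

(** * Translation into words when [d] divides [r] *)

Section Divisible.

Variable (q : nat).
Hypothesis r_eq : r = q * d.

Let q_lt_l : q < l. Proof. by rewrite -(ltn_pmul2r d_gt0) -r_eq. Qed.

Lemma offset_lt_r a o : o < d -> (a * d + o < r) = (a < q).
Proof.
move=> o_lt; rewrite r_eq -ltn_divLR // divnMDl // divn_small // addn0 //.
Qed.

(** Block [c + q.-1] is covered exactly by the edges [c] to [c + q.-1]. *)
Lemma sigma_window w c o :
  0 < q -> o < d ->
  sigma_e (tight_cycle n r t) w (vertex ((c + q.-1) * d + o)) =
  window_sum q (fun i => w (edge i)) c.
Proof.
move=> q_gt0 o_lt; rewrite (@sigma_vertex_count _ _ _ q) // ?(ltnW q_lt_l) //; last first.
  by move=> a; apply: offset_lt_r.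
rewrite (reindex_inj rev_ord_inj) /=; apply: eq_bigr => a _.
by congr (w _); rewrite -[RHS](edgeD _ 1); congr edge; have := ltn_ord a; lia.
Qed.

(** The blocks of [edge (i + q)] carry the window sums starting at [i.+1] to [i + q], and these are
    all equal iff [f j = f (j + q)] for [i < j < i + q]. *)
Lemma colorable_nowhere_periodicP k :
  0 < q ->
  sigma_e_colorable (tight_cycle n r t) k <->
  exists f : nat -> nat, [/\ forall i, 0 < f i <= k,
    forall i, f (i %% l) = f i & nowhere_periodic q f].
Proof.
move=> q_gt0; split=> [[w [w_le w_proper]] | [f [f_le f_mod f_np]]].
  exists (fun i => w (edge i)); split=> [i|i|i]; rewrite ?edge_mod ?w_le ?edge_in //.
  case: (boolP [exists j : 'I_q, (0 < j) && (w (edge (i + j)) != w (edge (i + j + q)))]).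
    by case/existsP=> j /andP[j_gt0 neq]; exists (i + j); split=> //; have := ltn_ord j; lia.
  move=> /existsPn noj.
  have sE : forall j, i < j < i + q -> w (edge j) = w (edge (j + q)).
    move=> j ij; have j_lt : j - i < q by lia.
    have := noj (Ordinal j_lt); rewrite /= negb_and negbK subnKC; last by lia.
    by case/orP => [|/eqP //]; lia.
  have [u [v [/mem_edgeP[a [o [_ o_lt + ->]]] /mem_edgeP[b [o' [_ o'_lt + ->]]]]]]:=
    w_proper _ (edge_in (i + q)).
  rewrite !offset_lt_r // => a_lt b_lt; case.
  rewrite (_ : i + q + a = i.+1 + a + q.-1); last by lia.
  rewrite (_ : i + q + b = i.+1 + b + q.-1); last by lia.
  by rewrite !sigma_window // !window_sum_const //.
pose w (e : {set 'I_n}) := if [pick i : 'I_l | edge i == e] is Some i then f i else 1.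
have wE i : w (edge i) = f i.
  rewrite /w; case: pickP => [j /eqP|/(_ (Ordinal (ltn_pmod i l_gt0)))].
    by rewrite -(edge_mod i) => /edge_inj -> //; rewrite ?ltn_pmod // f_mod.
  by rewrite /= edge_mod eqxx.
exists w; split=> e; rewrite {1}tight_cycleE => /imsetP[i _ ->]; first by rewrite wE.
(* The [q] extra turns [q * l] leave the edge unchanged and make room to subtract [q]. *)
have [j [ij neq]] := f_np (i + q * l - q).
have q_le : q <= q * l by rewrite leq_pmulr.
rewrite -(edgeD i q).
exists (vertex ((j + q.-1) * d + 0)), (vertex ((j.+1 + q.-1) * d + 0)); split.
- rewrite (_ : j + q.-1 = i + q * l + (j + q.-1 - (i + q * l))); last by lia.
  by rewrite mem_edge ?offset_lt_r //; lia.
- rewrite (_ : j.+1 + q.-1 = i + q * l + (j.+1 + q.-1 - (i + q * l))); last by lia.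
  by rewrite mem_edge ?offset_lt_r //; lia.
rewrite !sigma_window // => sE; have := window_sumS q (fun i => w (edge i)) j.
by rewrite -sE => /addnI; rewrite !wE => fE; rewrite fE eqxx in neq.
Qed.

End Divisible.

End TightCycle.

(** * The three values, according to the quotient of [r] by [r - t] *)

Theorem theorem3p5 (r t n l : nat)
    (t_ge1 : 1 <= t) (t_lt_r : t < r) (r_lt_n : r < n)
    (n_eq : n = l * (r - t)) (l_gt2 : 2 < l) :
  [/\ (t.*2 = r /\ ~ (4 %| l)) -> chi_e_is (tight_cycle n r t) 3,
      (t.*2 = r /\ 4 %| l) \/ (r < t.*2 /\ (r - t) %| r) ->
        chi_e_is (tight_cycle n r t) 2
    & ~ (t.*2 = r /\ ~ (4 %| l)) ->
      ~ ((t.*2 = r /\ 4 %| l) \/ (r < t.*2 /\ (r - t) %| r)) ->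
        chi_e_is (tight_cycle n r t) 1].
Proof.
have d_gt0 : 0 < r - t by rewrite subn_gt0.
have l_gt0 : 0 < l by lia.
rewrite {}n_eq in r_lt_n *.
have q2 : t.*2 = r -> r = 2 * (r - t) by lia.
(* The strict bound accounts for letters starting at 0 and weights at 1. *)
have pair k : t.*2 = r -> 2 - (4 %| l) < k ->
    sigma_e_colorable (tight_cycle (l * (r - t)) r t) k.
  move=> /q2 rE k_gt; apply/(colorable_nowhere_periodicP d_gt0 l_gt0 r_lt_n rE) => //.
  exists (fun i => (pair_coloring l (i %% l)).+1); split=> [i|i|i]; rewrite ?modn_mod //.
    by rewrite (leq_ltn_trans _ k_gt) // pair_coloring_le // ltn_pmod.
  by have [j [ij neq]] := pair_coloring_nowhere_periodic l_gt2 i; exists j; rewrite eqSS.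
have ge2 m : (r - t) %| r -> sigma_e_colorable (tight_cycle (l * (r - t)) r t) m -> 1 < m.
  case/dvdnP=> q rE /(colorable_nowhere_periodicP d_gt0 l_gt0 r_lt_n rE)[|f [f_le _ f_np]].
    by case: q rE => [|q] rE; lia.
  by have [j [_ /eqP]] := f_np 0; have := f_le j; have := f_le (j + q); lia.
split=> [[tr n4]|[[tr l4]|[r_lt /dvdnP[q rE]]]|n1 n2]; split.
- by apply: pair => //; case: dvdn n4.
- move=> m /(colorable_nowhere_periodicP d_gt0 l_gt0 r_lt_n (q2 tr))[//|f].
  case=> f_le f_mod f_np.
  rewrite leqNgt; apply/negP => m_lt; apply: n4.
  apply: (nowhere_periodic2_dvd4 _ f_mod f_np) => i.
  by have := f_le i; lia.
- by apply: pair; rewrite ?l4.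
- by move=> m; apply: ge2; apply/dvdnP; exists 2; apply: q2.
- have q_gt2 : 2 < q by case: q rE => [|[|[|q]]] rE; lia.
  have q_lt : q < l by rewrite -(ltn_pmul2r d_gt0) -rE.
  apply/(colorable_nowhere_periodicP d_gt0 l_gt0 r_lt_n rE); first by lia.
  exists (fun i => (block_coloring q l (i %% l)).+1); split=> [i|i|i]; rewrite ?modn_mod //.
    by case: block_coloring.
  have [j [ij neq]] := block_coloring_nowhere_periodic q_gt2 q_lt i; exists j; split=> //.
  by move: neq; do 2!case: block_coloring.
- by move=> m; apply: ge2; apply/dvdnP; exists q.
- apply: colorable1 => //; last by rewrite leq_subr.
  (* Since [t >= 1], divisibility forces [q >= 2]: [q = 2] means [t.*2 = r], and [q > 2] means
     [r < t.*2], both excluded. *)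
  apply/negP=> /dvdnP[q rE].
  have [tr | tr] := eqVneq t.*2 r.
    by apply: n2; left; split=> //; apply: contraT => n4; case: n1; split=> //; apply/negP.
  apply: n2; right; split; last by apply/dvdnP; exists q.
  by case: q rE => [|[|[|q]]] rE; lia.
by move=> m; apply: colorable_gt0.
Qed.
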